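(* Let $R$ be an associative ring with identity having countable left Krull dimension, and suppose that $R$ satisfies the ascending chain condition on semiprimitive (two-sided) ideals. Then each subset of $\operatorname{Irr} R$ that is closed under the refined Zariski topology is equal to $V(I) \cup S$ for some semiprimitive ideal $I$ of $R$ and some finite subset $S$ of $\operatorname{Irr} R$. In particular, the refined Zariski topology and the closed-point Zariski topology on $\operatorname{Irr} R$ coincide, and this topology is noetherian.
   Context: $R$ has countable left Krull dimension if the Gabriel-Rentschler Krull dimension of the left module ${}_RR$ exists and is a countable ordinal (finite values are allowed). ''Ideal'' means two-sided ideal. An ideal is semiprimitive if it is an intersection of annihilators of simple left $R$-modules (equivalently, $R/I$ has zero Jacobson radical); the empty intersection is allowed, so $R$ itself is a semiprimitive ideal. $\operatorname{Irr} R$ denotes the set of isomorphism classes of simple left $R$-modules, and for $p\in\operatorname{Irr} R$, $N_p$ denotes a chosen simple left $R$-module in the class $p$. Zariski topology on $\operatorname{Irr} R$: the closed sets are the sets $V(I)=\{p\in \operatorname{Irr} R \mid I N_p=0\}$ for ideals $I$ of $R$. Closed-point Zariski topology on $\operatorname{Irr} R$: the coarsest topology in which all one-point sets and all sets $V(I)$ are closed. Refined Zariski topology on $\operatorname{Irr} R$: a subset $X\subseteq \operatorname{Irr} R$ is closed if and only if the isomorphism class of every simple subquotient of the left $R$-module $\prod_{p\in X}N_p$ belongs to $X$. (It is known that these sets are the closed sets of a topology.) The product of an empty family of modules is the zero module. A topology is noetherian if its closed subsets satisfy the descending chain condition. *)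

(* Defs.v *)
From HB Require Import structures.
From mathcomp Require Import all_boot all_order all_algebra.
From mathcomp Require Import all_classical topology.

Set Implicit Arguments.
Unset Strict Implicit.
Unset Printing Implicit Defensive.

Import Order.TTheory GRing.Theory.

Local Open Scope classical_set_scope.
Local Open Scope ring_scope.

(* Modules are left modules over a possibly trivial, associative and unital
   ring [R : pzRingType].  Submodules, ideals, ... are [Prop]-valued sets. *)

Section Modules.
Context {R : pzRingType}.
Implicit Types M N S : lmodType R.

Definition submodule M (A : set M) := submod_closed [in A].

Definition simple_module M :=
  (exists x : M, x <> 0) /\
  forall A : set M, submodule A -> A = [set 0] \/ A = setT.

Definition isomorphic M N := exists f : {linear M -> N}, bijective f.

(* [S] is a subquotient of [M]: up to isomorphism, a quotient (via [q]) of a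
   submodule (via [i]) of [M]. *)
Definition subquotient S M :=
  exists (B : lmodType R) (i : {linear B -> M}) (q : {linear B -> S}),
    injective i /\ forall y : S, exists x : B, q x = y.

Definition annihilator M : set R := [set r | forall x : M, r *: x = 0].

Lemma submoduleP M (A : set M) :
  submodule A <-> A 0 /\ forall a u v, A u -> A v -> A (a *: u + v).
Proof.
split=> -[A0 AD]; split.
- by move: A0; rewrite !inE.
- move=> a u v Au Av; have := AD a u v; rewrite !inE; exact.
- by rewrite !inE.
- by move=> a u v; rewrite !inE; exact: AD.
Qed.

Lemma isomorphic_refl M : isomorphic M M.
Proof. by exists idfun; exists idfun. Qed.

Lemma bij_linear M N (f : {linear M -> N}) :
  injective f -> (forall y, exists x, f x = y) -> bijective f.
Proof.
move=> fI fS; pose g y := sval (cid (fS y)).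
have fg : cancel g f by move=> y; rewrite /g; case: cid.
by exists g => // x; apply: fI; rewrite fg.
Qed.

End Modules.

Section Product.
Context {R : pzRingType} {I : Type} (M : I -> lmodType R).

Definition prod_mod : Type := forall i, M i.

Implicit Types f g h : prod_mod.

HB.instance Definition _ := gen_eqMixin prod_mod.
HB.instance Definition _ := gen_choiceMixin prod_mod.

Let add f g : prod_mod := fun i => f i + g i.
Let opp f : prod_mod := fun i => - f i.
Let zero : prod_mod := fun i => 0.
Let scale (a : R) f : prod_mod := fun i => a *: f i.

Let addA : associative add.
Proof. by move=> f g h; apply: functional_extensionality_dep => i; exact: addrA. Qed.
Let addC : commutative add.
Proof. by move=> f g; apply: functional_extensionality_dep => i; exact: addrC. Qed.
Let add0 : left_id zero add.
Proof. by move=> f; apply: functional_extensionality_dep => i; exact: add0r. Qed.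
Let addN : left_inverse zero opp add.
Proof. by move=> f; apply: functional_extensionality_dep => i; exact: addNr. Qed.

HB.instance Definition _ := GRing.isZmodule.Build prod_mod addA addC add0 addN.

Let scaleA a b f : scale a (scale b f) = scale (a * b) f.
Proof. by apply: functional_extensionality_dep => i; exact: scalerA. Qed.
Let scale1 : left_id 1 scale.
Proof. by move=> f; apply: functional_extensionality_dep => i; exact: scale1r. Qed.
Let scaleDr : right_distributive scale +%R.
Proof. by move=> a f g; apply: functional_extensionality_dep => i; exact: scalerDr. Qed.
Let scaleDl f : {morph scale^~ f : a b / a + b}.
Proof. by move=> a b; apply: functional_extensionality_dep => i; exact: scalerDl. Qed.

HB.instance Definition _ :=
  GRing.Zmodule_isLmodule.Build R prod_mod scaleA scale1 scaleDr scaleDl.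

Lemma prod_addE f g i : (f + g) i = f i + g i. Proof. by []. Qed.
Lemma prod_scaleE a f i : (a *: f) i = a *: f i. Proof. by []. Qed.
Lemma prod_zeroE i : (0 : prod_mod) i = 0. Proof. by []. Qed.

End Product.

Section SubmoduleType.
Context {R : pzRingType} {M : lmodType R}.
Variables (A : set M) (Asub : submodule A).

Definition submod_pred of submodule A : {pred M} := [in A].

HB.instance Definition _ :=
  GRing.isSubmodClosed.Build R M (submod_pred Asub) (GRing.submod_closed_semi Asub).

Record submod_type := SubmodType { submod_val :> M; _ : submod_val \in submod_pred Asub }.

HB.instance Definition _ := [isSub for submod_val].
HB.instance Definition _ := [Choice of submod_type by <:].
HB.instance Definition _ := [SubChoice_isSubLmodule of submod_type by <:].

End SubmoduleType.


Section Irr.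
Context {R : pzRingType}.
Implicit Types M N S : lmodType R.

(* For a simple module [M] this is the set of the maximal left ideals [L] such
   that [R / L] is isomorphic to [M].  It encodes the isomorphism class of [M]
   (see [simple_class_eq]) by a set that lives in the universe of [R]; the
   predicate "isomorphic to [M]" on [lmodType R] is too large to index a
   product of modules. *)
Definition simple_class M : set (set R) :=
  [set L | exists2 x : M, x <> 0 & L = [set r | r *: x = 0]].

Lemma simple_cyclic M (x : M) : simple_module M -> x <> 0 ->
  forall y, exists r : R, r *: x = y.
Proof.
move=> [_ sM] x0 y.
have sub : submodule [set r *: x | r in [set: R]].
  apply/submoduleP; split; first by exists 0 => //; rewrite scale0r.
  move=> a _ _ [r _ <-] [s _ <-]; exists (a * r + s) => //.
  by rewrite scalerDl scalerA.
case: (sM _ sub) => [E|E].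
  have : [set r *: x | r in [set: R]] x by exists 1 => //; rewrite scale1r.
  by rewrite E => /x0.
have : [set: M] y by [].
by rewrite -E => -[r _ <-]; exists r.
Qed.

Lemma simple_class_eq M N : simple_module M -> simple_module N ->
  simple_class M = simple_class N <-> isomorphic M N.
Proof.
move=> sM sN; split=> [E|[f fbij]].
  have [[x x0] _] := sM.
  have : simple_class M [set r | r *: x = 0] by exists x.
  rewrite E => -[y y0 /seteqP [xy yx]].
  have cM := simple_cyclic sM x0; have cN := simple_cyclic sN y0.
  pose f m := sval (cid (cM m)) *: y.
  have fE r : f (r *: x) = r *: y.
    rewrite /f; case: cid => s /= sE; apply/eqP; rewrite -subr_eq0 -scalerBl.
    by apply/eqP; apply: xy => /=; rewrite scalerBl sE subrr.
  have flin : linear f.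
    move=> a u v; have [[r <-] [s <-]] := (cM u, cM v).
    by rewrite scalerA -scalerDl !fE scalerDl scalerA.
  pose F := GRing.isLinear.Build R M N _ f flin.
  pose G : {linear M -> N} := HB.pack f F.
  exists G; apply: bij_linear => [u v|z].
    have [[r <-] [s <-]] := (cM u, cM v); rewrite /= !fE => /eqP.
    rewrite -subr_eq0 -scalerBl => /eqP rs.
    by apply/eqP; rewrite -subr_eq0 -scalerBl; apply/eqP; apply: yx.
  by have [r <-] := cN z; exists (r *: x); rewrite /= fE.
have fI := bij_inj fbij; have [g fg gf] := fbij.
have f0 u : f u = 0 -> u = 0 by move=> fu; apply: fI; rewrite fu raddf0.
apply/seteqP; split=> _ [x x0 ->].
  exists (f x); first by move=> /f0.
  apply/seteqP; split=> r /=; first by rewrite -linearZ_LR => ->; rewrite raddf0.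
  by rewrite -linearZ_LR => /f0.
exists (g x); first by move=> gx; apply: x0; rewrite -(gf x) gx raddf0.
apply/seteqP; split=> r /=.
  by move=> rx; apply: f0; rewrite linearZ_LR gf.
by move=> rx; rewrite -(gf x) -linearZ_LR rx raddf0.
Qed.

End Irr.

Section IrrType.
Variable R : pzRingType.

Definition Irr := {C : set (set R) |
  exists2 M : lmodType R, simple_module M & C = simple_class M}.

Lemma Irr_inj (p q : Irr) : sval p = sval q -> p = q.
Proof.
by case: p q => [C hC] [D hD] /= E; subst D; congr exist; exact: Prop_irrelevance.
Qed.

Definition Irr_of (M : lmodType R) (sM : simple_module M) : Irr :=
  exist _ (simple_class M) (ex_intro2 _ _ M sM erefl).

(* The chosen simple module [N_p] in the class [p]. *)
Definition Irr_mod (p : Irr) : lmodType R := s2val (cid2 (svalP p)).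

Lemma Irr_mod_simple p : simple_module (Irr_mod p).
Proof. exact: s2valP (cid2 (svalP p)). Qed.

Lemma Irr_modK p : Irr_of (Irr_mod_simple p) = p.
Proof. by apply: Irr_inj; rewrite /= -(s2valP' (cid2 (svalP p))). Qed.

Lemma Irr_of_eq (M N : lmodType R) (sM : simple_module M)
  (sN : simple_module N) : Irr_of sM = Irr_of sN <-> isomorphic M N.
Proof.
rewrite -simple_class_eq //; split=> [[]//|E]; exact: Irr_inj.
Qed.

End IrrType.

Section Ideals.
Variable R : pzRingType.

Definition ideal (I : set R) :=
  submodule (I : set R^o) /\ forall x r, I x -> I (x * r).

Definition semiprimitive (I : set R) :=
  exists (J : Type) (M : J -> lmodType R),
    (forall j, simple_module (M j)) /\ I = \bigcap_j annihilator (M j).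

Definition acc_semiprimitive :=
  forall I : nat -> set R, (forall n, semiprimitive (I n)) ->
    (forall n, I n `<=` I n.+1) ->
    exists n, forall m, (n <= m)%N -> I m = I n.

Definition zariski_closed (I : set R) : set (Irr R) :=
  [set p | I `<=` annihilator (Irr_mod p)].

Lemma semiprimitive_ideal I : semiprimitive I -> ideal I.
Proof.
move=> [J [M [_ ->]]]; split.
  apply/submoduleP; split=> [j _ x|a u v Iu Iv j _ x]; first by rewrite scale0r.
  by rewrite scalerDl -scalerA (Iu j Logic.I x) (Iv j Logic.I x) scaler0 addr0.
by move=> u r Iu j _ x; rewrite -scalerA; apply: Iu.
Qed.

End Ideals.

Section Krull.
Context {R : pzRingType} {M : lmodType R} {d : Order.disp_t} {W : orderType d}.
Implicit Types (A B : set M) (a b : W).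

(* One stage of the transfinite recursion defining the Krull dimension of the
   subfactor [B / A] of [M], where [A `<=` B] are submodules.  [kdim b _ A' B']
   says that [B' / A'] has Krull dimension [b], for [b < a].  The zero module
   has Krull dimension -1, which is not represented in [W]. *)
Definition krull_step a (kdim : forall b, (b < a)%O -> set M -> set M -> Prop)
    A B : Prop :=
  [/\ A <> B,
      forall b (ba : (b < a)%O), ~ kdim b ba A B
    & forall C : nat -> set M,
        (forall n, [/\ submodule (C n), A `<=` C n & C n `<=` B]) ->
        (forall n, C n.+1 `<=` C n) ->
        exists n0, forall n, (n0 <= n)%N ->
          C n.+1 = C n \/ exists b (ba : (b < a)%O), kdim b ba (C n.+1) (C n)].

Variable wfW : well_founded (fun a b : W => (a < b)%O).

(* Ordinals are represented by elements of a well-ordered type: [a : W] stands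
   for the order type of the initial segment [[set b | b < a]]. *)
Definition krull_dim_factor : W -> set M -> set M -> Prop :=
  Fix wfW (fun=> set M -> set M -> Prop) krull_step.

Definition krull_dim : W -> Prop := fun a => krull_dim_factor a [set 0] setT.

Lemma krull_dim_factorE a A B :
  krull_dim_factor a A B = krull_step (fun b (_ : (b < a)%O) => krull_dim_factor b) A B.
Proof.
rewrite /krull_dim_factor Fix_eq // => x f g fg.
by congr krull_step; apply: functional_extensionality_dep => y; apply/funext => h.
Qed.

End Krull.

(* The zero module, of Krull dimension -1, is included. *)
Definition has_countable_krull_dim (R : pzRingType) (M : lmodType R) :=
  (forall x : M, x = 0) \/
  exists (d : Order.disp_t) (W : orderType d)
    (wfW : well_founded (fun a b : W => (a < b)%O)) (a : W),
    countable [set b | (b < a)%O] /\ krull_dim (M := M) wfW a.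

Definition countable_left_krull_dim (R : pzRingType) :=
  has_countable_krull_dim (R^o : lmodType R).

Section Refined.
Variable R : pzRingType.
Implicit Types X Y : set (Irr R).

Definition Irr_prod X : lmodType R :=
  prod_mod (fun p : {p : Irr R | X p} => Irr_mod (sval p)).

Definition refined_closed X :=
  forall (S : lmodType R) (sS : simple_module S),
    subquotient S (Irr_prod X) -> X (Irr_of sS).

Definition ext0 X Y (f : Irr_prod X) : Irr_prod Y :=
  fun p => match pselect (X (sval p)) with
           | left Xp => f (exist _ (sval p) Xp)
           | right _ => 0
           end.

Lemma ext0_linear X Y : linear (@ext0 X Y).
Proof.
move=> a f g; apply: functional_extensionality_dep => p.
rewrite prod_addE prod_scaleE /ext0; case: pselect => [Xp|_].
  by rewrite prod_addE prod_scaleE.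
by rewrite scaler0 addr0.
Qed.

HB.instance Definition _ X Y :=
  GRing.isLinear.Build R (Irr_prod X) (Irr_prod Y) _ (@ext0 X Y) (@ext0_linear X Y).

Lemma ext0E X Y (f : Irr_prod X) p (Yp : Y p) (Xp : X p) :
  ext0 f (exist Y p Yp) = f (exist X p Xp).
Proof.
by rewrite /ext0 /=; case: pselect => // Xp'; rewrite (Prop_irrelevance Xp' Xp).
Qed.

Lemma ext0_inj X Y : X `<=` Y -> injective (@ext0 X Y).
Proof.
move=> XY f g fg; apply: functional_extensionality_dep => -[p Xp].
by rewrite -(ext0E f (XY _ Xp)) fg ext0E.
Qed.

Lemma subquotient_sub (S M N : lmodType R) (f : {linear M -> N}) :
  injective f -> subquotient S M -> subquotient S N.
Proof.
move=> fI [B [i [q [iI qS]]]].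
by exists B, (f \o i : {linear B -> N}), q; split=> //; exact: inj_comp.
Qed.

Lemma refined_closed0 : refined_closed set0.
Proof.
move=> S sS [B [i [q [iI qS]]]]; exfalso; have [[s s0] _] := sS; apply: s0.
have [x <-] := qS s; suff -> : x = 0 by rewrite raddf0.
by apply: iI; apply: functional_extensionality_dep => -[].
Qed.

Lemma refined_closed_bigcap (I : Type) (F : I -> set (Irr R)) :
  (forall i, refined_closed (F i)) -> refined_closed (\bigcap_i F i).
Proof.
move=> Fc S sS sq i _; apply: Fc.
have FI : \bigcap_i F i `<=` F i by move=> p; apply.
exact: (@subquotient_sub S _ _ (@ext0 (\bigcap_i F i) (F i)) (ext0_inj FI)).
Qed.

Lemma subquotientU (S M N P : lmodType R) (f : {linear P -> M})
    (g : {linear P -> N}) : simple_module S ->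
  (forall x, f x = 0 -> g x = 0 -> x = 0) ->
  subquotient S P -> subquotient S M \/ subquotient S N.
Proof.
move=> [[s s0] sS] fg0 [B [i [q [iI qS]]]].
have i0 x : i x = 0 -> x = 0 by move=> ix; apply: iI; rewrite ix raddf0.
pose K : set B := [set x | f (i x) = 0].
have subK : submodule K.
  apply/submoduleP; split=> [|a u v /= Ku Kv]; first by rewrite /K /= !raddf0.
  by rewrite /K /= !linearP Ku Kv scaler0 addr0.
have subqK : submodule [set q x | x in K].
  apply/submoduleP; case/submoduleP: subK => K0 KD; split.
    by exists 0 => //; rewrite raddf0.
  move=> a _ _ [u Ku <-] [v Kv <-]; exists (a *: u + v); first exact: KD.
  by rewrite linearP.
case: (sS _ subqK) => qK; [left|right].
  pose I : set M := [set f (i x) | x in [set: B]].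
  have subI : submodule I.
    apply/submoduleP; split; first by exists 0 => //; rewrite !raddf0.
    move=> a _ _ [u _ <-] [v _ <-]; exists (a *: u + v) => //.
    by rewrite !linearP.
  pose T := submod_type subI.
  have TE (t : T) : exists x, f (i x) = val t.
    by have := valP t; rewrite inE => -[x _ xt]; exists x.
  pose h (t : T) : S := q (sval (cid (TE t))).
  have hE (t : T) x : f (i x) = val t -> h t = q x.
    rewrite /h; case: cid => y /= yt xt; apply/eqP; rewrite -subr_eq0 -raddfB.
    have : [set q x | x in K] (q (y - x)).
      by exists (y - x) => //; rewrite /K /= !raddfB /= yt xt subrr.
    by rewrite qK => /= ->.
  have hlin : linear h.
    move=> a u v; have [[x xu] [y yv]] := (TE u, TE v).
    rewrite (hE _ _ xu) (hE _ _ yv) (hE _ (a *: x + y)) ?linearP//.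
    by rewrite xu yv.
  pose H : {linear T -> S} := HB.pack h (GRing.isLinear.Build R T S _ h hlin).
  exists T, (val : {linear T -> M}), H; split; first exact: val_inj.
  move=> y; have [x xy] := qS y.
  have Ix : f (i x) \in submod_pred subI by rewrite inE; exists x.
  by exists (SubmodType Ix); rewrite /= (hE _ x).
pose T := submod_type subK.
exists T, (g \o (i \o (val : {linear T -> B}))), (q \o (val : {linear T -> B})).
split=> [u v /= guv|y].
  apply/val_inj/eqP; rewrite -subr_eq0; apply/eqP/i0/fg0.
    have := valP u; have := valP v; rewrite !inE => Kv Ku.
    by rewrite !raddfB /= Ku Kv subrr.
  by rewrite !raddfB /= guv subrr.
have : [set: S] y by []; rewrite -qK => -[x Kx <-].
have Kx' : x \in submod_pred subK by rewrite inE.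
by exists (SubmodType Kx').
Qed.

Lemma refined_closedU X Y :
  refined_closed X -> refined_closed Y -> refined_closed (X `|` Y).
Proof.
move=> Xc Yc S sS.
move=> /(@subquotientU S _ _ _ (@ext0 (X `|` Y) X) (@ext0 (X `|` Y) Y) sS) [].
- move=> f fX fY; apply: functional_extensionality_dep => -[p XYp].
  have [Xp|Yp] := XYp.
    by rewrite -(ext0E f Xp XYp) fX.
  by rewrite -(ext0E f Yp XYp) fY.
- by move=> /Xc Xp; left.
- by move=> /Yc Yp; right.
Qed.

End Refined.

(* [Irr R] with the refined Zariski topology. *)
Definition refined_Irr (R : pzRingType) := Irr R.

(* [Irr R] with the closed-point Zariski topology. *)
Definition closed_point_Irr (R : pzRingType) := Irr R.

Section Topologies.
Variable R : pzRingType.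

HB.instance Definition _ := gen_eqMixin (refined_Irr R).
HB.instance Definition _ := gen_choiceMixin (refined_Irr R).

Let op : set_system (refined_Irr R) := [set U | @refined_closed R (~` U)].

Let opT : op setT.
Proof. by rewrite /op /= setCT; exact: refined_closed0. Qed.

Let opI : setI_closed op.
Proof. by move=> U V Uo Vo; rewrite /op /= setCI; exact: refined_closedU. Qed.

Let op_bigU (I : Type) (f : I -> set (refined_Irr R)) :
  (forall i, op (f i)) -> op (\bigcup_i f i).
Proof. by move=> fo; rewrite /op /= setC_bigcup; exact: refined_closed_bigcap. Qed.

HB.instance Definition _ :=
  isOpenTopological.Build (refined_Irr R) opT opI op_bigU.

Lemma closed_refinedE (X : set (refined_Irr R)) :
  closed X <-> refined_closed X.
Proof. by rewrite -openC -[X in refined_closed X]setCK. Qed.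

HB.instance Definition _ := gen_eqMixin (closed_point_Irr R).
HB.instance Definition _ := gen_choiceMixin (closed_point_Irr R).

(* The complements of the points and of the Zariski closed sets form a
   subbase. *)
Definition closed_point_subbase : set (set (closed_point_Irr R)) :=
  [set U | (exists p, U = ~` [set p]) \/
           (exists2 I, ideal I & U = ~` zariski_closed I)].

HB.instance Definition _ :=
  @isSubBaseTopological.Build (closed_point_Irr R) (set (closed_point_Irr R))
    closed_point_subbase idfun.

End Topologies.

Definition noetherian_topology (T : topologicalType) :=
  forall C : nat -> set T, (forall n, closed (C n)) ->
    (forall n, C n.+1 `<=` C n) ->
    exists n, forall m, (n <= m)%N -> C m = C n.

(* Main.v *)
Require Import Defs.
From HB Require Import structures.
From mathcomp Require Import all_boot all_order all_algebra.
From mathcomp Require Import all_classical topology.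

(* If every subset of [Y] with finite complement in [Y] has the same annihilator
   [I] as [Y], then [R/I] embeds in the product of the [N_p],
   [p \in Y], so that every simple [R/I]-module is a subquotient of it.  By the
   chain condition every refined closed [X] contains such a [Y] with [X `\` Y]
   finite, hence [X = V(I) `|` (X `\` Y)].

   For the embedding, countable Krull dimension says that every intersection of
   left ideals is already an intersection of countably many of them.  Hence each
   [N_p] has a sequence [e_p] whose joint annihilator is that of [N_p].  The
   chain condition and Zorn's lemma give disjoint [D_s] in [Y], indexed by the
   nodes [s] of the tree of finite sequences of naturals, each with annihilator
   [I].  A branch [b] of the tree gives the element with components
   [e_p (b n)] for [p] in [D_(b|n)]; let [L_b] be the left ideal of the [r]
   killing all but finitely many levels of it.  The [L_b] intersect in [I], so
   countably many branches suffice, and since distinct branches are eventually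
   disjoint the corresponding elements can be merged into a single one. *)

Import Order.TTheory GRing.Theory.

Local Open Scope classical_set_scope.
Local Open Scope ring_scope.

(** * Countable Krull dimension and intersections of submodules *)

Section CountableKrullDim.
Set Implicit Arguments.
Unset Strict Implicit.
Context {R : pzRingType} {M : lmodType R}.

Lemma submodule_bigcap (J : Type) (D : set J) (L : J -> set M) :
  (forall j, submodule (L j)) -> submodule (\bigcap_(j in D) L j).
Proof.
move=> subL; apply/submoduleP; split=> [j _|a u v Lu Lv j Dj].
  by have /submoduleP [] := subL j.
by have /submoduleP [_] := subL j; apply; [exact: Lu|exact: Lv].
Qed.

Section WellOrder.
Context {d : Order.disp_t} {W : orderType d}.
Variable wfW : well_founded (fun a b : W => (a < b)%O).
Implicit Types (A B : set M) (a b c : W).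

Local Notation kdim := (krull_dim_factor wfW).

Lemma krull_dim_factor_uniq a b A B : kdim a A B -> kdim b A B -> a = b.
Proof.
move=> ka kb; case: (ltgtP a b) => [ab|ba|//].
- by move: kb; rewrite krull_dim_factorE => -[_ /(_ a ab)].
- by move: ka; rewrite krull_dim_factorE => -[_ /(_ b ba)].
Qed.

(** A chain between [A'] and [B'] is also one between [A] and [B], so it meets the chain condition
    for [a]; hence [a] is the dimension unless a smaller [b] is. *)
Lemma krull_dim_factor_sub a A B A' B' : A `<=` A' -> B' `<=` B -> A' <> B' ->
  kdim a A B -> exists2 b, (b <= a)%O & kdim b A' B'.
Proof.
move=> AA BB neq; rewrite krull_dim_factorE => -[_ _ chain].
have [[b ba kb]|nb] := pselect (exists2 b, (b < a)%O & kdim b A' B').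
  by exists b => //; exact: ltW.
exists a => //; rewrite krull_dim_factorE; split=> // [b ba kb|C CAB Cdec].
  by apply: nb; exists b.
apply: chain => // n; have [sC AC CB] := CAB n.
by split=> //; [exact: subset_trans AC|exact: subset_trans BB].
Qed.

Lemma krull_dim_factor_chain a A B (C : nat -> set M) : kdim a A B ->
  (forall n, submodule (C n)) -> (forall n, A `<=` C n) ->
  (forall n, C n `<=` B) -> (forall n, C n.+1 `<=` C n) ->
  ~ forall n, kdim a (C n.+1) (C n).
Proof.
rewrite krull_dim_factorE => -[_ _ chain] sC AC CB Cdec Ck.
have [n /(_ n (leqnn n))] := chain _ (fun n => And3 (sC n) (AC n) (CB n)) Cdec.
case=> [E|[b [ba kb]]].
  by have := Ck n; rewrite krull_dim_factorE E => -[].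
by move: ba; rewrite (krull_dim_factor_uniq kb (Ck n)) ltxx.
Qed.

Variables (J : Type) (j0 : J) (L : J -> set M).
Hypothesis subL : forall j, submodule (L j).

Local Notation C u := (\bigcap_(n in [set: nat]) L (u n)).

(** By pairing naturals, countably many countable intersections form one, so countably many
    conditions can be imposed at once. *)
Lemma merge_bigcap (u : nat -> nat -> J) :
  exists v, C v = \bigcap_k C (u k).
Proof.
exists (fun n => if unpickle n is Some (k, i) then u k i else u 0 0).
apply/seteqP; split=> x Cx.
  by move=> k _ i _; have := Cx (pickle (k, i)) Logic.I; rewrite pickleK.
by move=> n _; case: unpickle => [[k i]|]; exact: Cx.
Qed.

(** By contradiction. If no [C u] lies in all [L j], the dimension of [C u / C w] is constant for
    all small enough [C w]. Where this constant is least, say [c], there is an infinite descending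
    chain with all factors of dimension [c] inside a factor of dimension [c]. *)
Lemma krull_dim_bigcap a : countable [set b | (b < a)%O] ->
  krull_dim (M := M) wfW a ->
  exists u : nat -> J, C u `<=` \bigcap_j L j.
Proof.
move=> /countable_injP [g0 g0I] ka.
(* An injective coding of the [b <= a]; 0 is kept for [a], as the countability given concerns only
   [b < a]. *)
pose g b := if (b < a)%O then (g0 b).+1 else 0.
have gI b c : (b <= a)%O -> (c <= a)%O -> g b = g c -> b = c.
  rewrite /g !le_eqVlt => /orP[/eqP->|ba] /orP[/eqP->|ca]; rewrite ?ltxx //.
  - by rewrite ca.
  - by rewrite ba.
  by rewrite ba ca => -[]; apply: g0I; rewrite inE.
have subC u : submodule (C u) by apply: submodule_bigcap.
have dimC u v : C v <> C u -> exists2 b, (b <= a)%O & kdim b (C v) (C u).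
  move=> vu; apply: krull_dim_factor_sub ka => // _ ->.
  by have /submoduleP [] := subC v.
apply: contrapT => nmin.
have shrink u : exists2 v, C v `<=` C u & C v <> C u.
  have [x [Cx [j nL]]] : exists x, C u x /\ exists j, ~ L j x.
    apply: contrapT => H; apply: nmin; exists u => x Cx j _.
    by apply: contrapT => nL; apply: H; exists x; split=> //; exists j.
  have [v vE] := merge_bigcap (fun k => if k is 0 then u else fun=> j).
  exists v; rewrite vE; first by move=> y /(_ 0 Logic.I).
  by move=> E; apply: nL; move: Cx; rewrite -E => /(_ 1 Logic.I) /(_ 0 Logic.I).
(* [c] is the largest Krull dimension of a [C u / C w]; it is attained at [v]
   and below. *)
pose stable u c v := C v `<=` C u /\
  forall w, C w `<=` C v -> kdim c (C w) (C u).
have ex_stable u : exists c v, stable u c v.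
  (* [v] attains the dimension coded by [n] if anything below [u] does. *)
  pose P n v := C v `<=` C u /\
    forall b v', (b <= a)%O -> g b = n -> C v' `<=` C u ->
      kdim b (C v') (C u) -> kdim b (C v) (C u).
  have exP n : exists v, P n v.
    have [[v [b [ba bn vu kv]]]|H] := pselect (exists v b,
        [/\ (b <= a)%O, g b = n, C v `<=` C u & kdim b (C v) (C u)]).
      exists v; split=> // c v' ca cn _ _.
      by rewrite (gI c b ca ba (etrans cn (esym bn))).
    by exists u; split=> // b v' ba bn v'u kv'; case: H; exists v', b.
  have [vs vsP] := choice exP.
  have [w1 w1u w1n] := shrink u.
  (* Including [w1] keeps [C v] strictly below [C u], so the factors are nonzero. *)
  have [v vE] := merge_bigcap (fun k => if k is k'.+1 then vs k' else w1).
  have vw1 : C v `<=` C w1 by rewrite vE => x /(_ 0 Logic.I).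
  have vvs k : C v `<=` C (vs k) by rewrite vE => x /(_ k.+1 Logic.I).
  have neq w : C w `<=` C v -> C w <> C u.
    move=> wv E; apply: w1n; apply/seteqP; split=> //.
    by rewrite -E; exact: subset_trans vw1.
  have [c ca kc] := dimC u v (neq v (fun=> id)).
  exists c, v; split=> [|w wv]; first exact: subset_trans w1u.
  have wu : C w `<=` C u := subset_trans wv (subset_trans vw1 w1u).
  have [b ba kb] := dimC u w (neq w wv).
  have [_ /(_ b w ba erefl wu kb) kb'] := vsP (g b).
  (* [c <= b] as [C w `<=` C v], and [b <= c] as [C v `<=` C (vs (g b))]. *)
  have [c' c'c kc'] := krull_dim_factor_sub wv (@subset_refl _ (C u))
    (neq v (fun=> id)) kb.
  have [b' b'b kb''] : exists2 b', (b' <= c)%O & kdim b' (C (vs (g b))) (C u).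
    apply: krull_dim_factor_sub kc => //.
    by move=> E; move: kb'; rewrite krull_dim_factorE => -[].
  have <- : b = c => //; apply/le_anti.
  by rewrite (krull_dim_factor_uniq kb' kb'') b'b
    -(krull_dim_factor_uniq kb' kb'') (krull_dim_factor_uniq kc kc') c'c.
have [c [[u [v0 uv0]] cmin]] : exists c, (exists u v, stable u c v) /\
    forall b, (exists u v, stable u b v) -> ~ (b < c)%O.
  have [c [v cv]] := ex_stable (fun=> j0).
  have : exists u v, stable u c v by exists (fun=> j0), v.
  elim/(well_founded_ind wfW): c {v cv} => c IH cs.
  have [[b bs bc]|H] :=
    pselect (exists2 b, (exists u v, stable u b v) & (b < c)%O).
    exact: IH bs.
  by exists c; split=> // b bs bc; apply: H; exists b.
have [v0u kv0] := uv0.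
have below w : C w `<=` C u -> exists2 v, C v `<=` C w & kdim c (C v) (C w).
  move=> wu; have [b [v [vw kv]]] := ex_stable w.
  (* Lying below [v0] bounds the dimension of [C w / C t] by [c]; lying below [v] makes it the
     stable dimension of [w], which is not below [c]. *)
  have [t tE] := merge_bigcap (fun k => if k is 0 then v else v0).
  have tv : C t `<=` C v by rewrite tE => x /(_ 0 Logic.I).
  have tv0 : C t `<=` C v0 by rewrite tE => x /(_ 1 Logic.I).
  have tw : C t <> C w.
    by move=> E; have := kv _ tv; rewrite krull_dim_factorE E => -[].
  have [b' b'c kb'] :=
    krull_dim_factor_sub (@subset_refl _ (C t)) wu tw (kv0 _ tv0).
  exists t; first exact: subset_trans vw.
  move: b'c; rewrite le_eqVlt => /orP[/eqP<-//|b'c]; case: (cmin b') => //.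
  by exists w, v; rewrite (krull_dim_factor_uniq kb' (kv _ tv)).
pose T := {w : nat -> J | C w `<=` C u}.
have next (s : T) : {t : T | C (sval t) `<=` C (sval s) /\
    kdim c (C (sval t)) (C (sval s))}.
  apply: cid; case: s => w wu; have [v vw kv] := below w wu.
  by exists (exist _ v (subset_trans vw wu)).
have [f [f0 fS]] := dependent_choice next (exist _ u (@subset_refl _ (C u))).
(* Below the whole chain and below [C v0], so [C u / C w] has dimension [c] and contains the
   chain. *)
have [w wE] := merge_bigcap (fun k => if k is k'.+1 then sval (f k') else v0).
have wv0 : C w `<=` C v0 by rewrite wE => x /(_ 0 Logic.I).
apply: (krull_dim_factor_chain (kv0 w wv0) (C := fun n => C (sval (f n)))).
- by move=> n; exact: subC.
- by move=> n; rewrite wE => x /(_ n.+1 Logic.I).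
- by move=> n; exact: (svalP (f n)).
- by move=> n; exact: (fS n).1.
- by move=> n; exact: (fS n).2.
Qed.

End WellOrder.

Lemma countable_krull_dim_bigcap (J : Type) (j0 : J) (L : J -> set M) :
  has_countable_krull_dim M -> (forall j, submodule (L j)) ->
  exists u : nat -> J, \bigcap_n L (u n) `<=` \bigcap_j L j.
Proof.
move=> [M0|[d [W [wfW [a [ca ka]]]]]] subL; last exact: krull_dim_bigcap ka.
exists (fun=> j0) => x _ j _; rewrite (M0 x).
by have /submoduleP [] := subL j.
Qed.

End CountableKrullDim.

(** * Annihilators of sets of simple modules *)

Lemma infinite_set_seq (T : Type) (A : set T) : infinite_set A ->
  exists f : nat -> T, injective f /\ forall n, A (f n).
Proof.
move=> /infiniteP /card_leP [f].
have f_inj := @inj _ _ _ f.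
exists (fun n => sval (f (to_setT n))); split=> [m n mn|n]; last first.
  by have := valP (f (to_setT n)); rewrite inE.
have /(f_inj) : f (to_setT m) = f (to_setT n).
  exact: val_inj.
by rewrite !inE => /(_ Logic.I Logic.I) [].
Qed.

Section IrrAnn.
Set Implicit Arguments.
Unset Strict Implicit.
Context {R : pzRingType}.
Implicit Types (X Y Z W : set (Irr R)) (p q : Irr R).

(** The largest [I] with [X] contained in [zariski_closed I]. *)
Definition Irr_ann X : set R := \bigcap_(p in X) annihilator (Irr_mod p).

Lemma Irr_annS X Y : X `<=` Y -> Irr_ann Y `<=` Irr_ann X.
Proof. by move=> XY r Yr p /XY; exact: Yr. Qed.

Lemma semiprimitive_Irr_ann X : semiprimitive (Irr_ann X).
Proof.
exists {p : Irr R | X p}, (fun p : {p : Irr R | X p} => Irr_mod (sval p)).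
split.
  by move=> p; exact: Irr_mod_simple.
apply/seteqP; split=> r Xr; first by move=> [p Xp] _; exact: Xr.
by move=> p Xp; exact: (Xr (exist _ p Xp)).
Qed.

Lemma acc_semiprimitive_max (P : set (set R)) : acc_semiprimitive R ->
  P !=set0 -> P `<=` @semiprimitive R ->
  exists2 I, P I & forall J, P J -> I `<=` J -> J = I.
Proof.
move=> acc [I0 PI0] Psp; apply: contrapT => nmax.
have next (I : {I | P I}) :
    {J : {J | P J} | sval I `<=` sval J /\ sval J <> sval I}.
  apply: cid; case: I => I PI; apply: contrapT => H; apply: nmax.
  exists I => // J PJ IJ; apply: contrapT => JI; apply: H.
  by exists (exist _ J PJ).
have [f [_ fS]] := dependent_choice next (exist _ I0 PI0).
have [n /(_ n.+1 (leqnSn n))] := acc (fun n => sval (f n))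
  (fun n => Psp _ (svalP (f n))) (fun n => (fS n).1).
exact: (fS n).2.
Qed.

Hypothesis acc : acc_semiprimitive R.

(** [W] has maximal annihilator among the infinite subsets of [Z]; shrinking it can only enlarge the
    annihilator. *)
Lemma infinite_sub_Irr_ann Z : infinite_set Z -> exists W,
  [/\ W `<=` Z, infinite_set W & forall W', W' `<=` W -> infinite_set W' ->
    Irr_ann W' `<=` Irr_ann W].
Proof.
move=> Zinf.
have [|_ [W _ <-]|_ [W [WZ Winf] <-] Wmax] := acc_semiprimitive_max
  (P := [set Irr_ann W | W in [set W | W `<=` Z /\ infinite_set W]]) acc.
- by exists (Irr_ann Z), Z; split=> //; exact: Zinf.
- exact: semiprimitive_Irr_ann.
exists W; split=> // W' W'W W'inf.
rewrite -(Wmax (Irr_ann W')) //; last exact: Irr_annS.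
by exists W' => //; split=> //; exact: subset_trans WZ.
Qed.

Lemma cofinite_Irr_ann_max X : exists Y, [/\ Y `<=` X, finite_set (X `\` Y) &
  forall Y', Y' `<=` Y -> finite_set (Y `\` Y') -> Irr_ann Y' `<=` Irr_ann Y].
Proof.
have [|_ [Y _ <-]|_ [Y [YX Yfin] <-] Ymax] := acc_semiprimitive_max
  (P := [set Irr_ann Y | Y in [set Y | Y `<=` X /\ finite_set (X `\` Y)]]) acc.
- by exists (Irr_ann X), X; split=> //; rewrite setDv; exact: finite_set0.
- exact: semiprimitive_Irr_ann.
exists Y; split=> // Y' Y'Y Y'fin.
rewrite -(Ymax (Irr_ann Y')) //; last exact: Irr_annS.
exists Y' => //; split; first exact: subset_trans YX.
apply: (@sub_finite_set _ _ ((X `\` Y) `|` (Y `\` Y'))).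
  by move=> p [Xp nY']; have [Yp|nYp] := pselect (Y p); [right|left].
by rewrite finite_setU.
Qed.

(** Take a maximal disjoint family whose members share one annihilator, that of their union [U]. If
    [U] missed infinitely many points of [X], an infinite set of them as in [infinite_sub_Irr_ann]
    could be distributed over the members. So [U] is cofinite in [X]. *)
Lemma disjoint_Irr_ann (T : countType) (t0 : T) X :
  (forall Y, Y `<=` X -> finite_set (X `\` Y) -> Irr_ann Y `<=` Irr_ann X) ->
  exists D : T -> set (Irr R),
    [/\ forall t, D t `<=` X, forall s t p, D s p -> D t p -> s = t
      & forall t, Irr_ann (D t) `<=` Irr_ann X].
Proof.
move=> Xcof.
(* Families are encoded as sets of pairs, so that Zorn's lemma applies to inclusion. *)
pose D (A : set (Irr R * T)) t : set (Irr R) := [set p | A (p, t)].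
pose P (A : set (Irr R * T)) := [/\ forall t, D A t `<=` X,
  forall s t p, D A s p -> D A t p -> s = t
  & forall s t p, D A t p -> Irr_ann (D A s) `<=` annihilator (Irr_mod p)].
have [|A [[AX Adisj Aann] Amax]] := @Zorn_bigcup _ P.
  move=> F FP Ftot; split.
  - by move=> t p [A /FP [AX _ _]]; exact: AX.
  - move=> s t p [A FA As] [B FB Bt]; case: (Ftot A B FA FB) => AB.
      by have [_ + _] := FP _ FB; apply; [exact: AB As|exact: Bt].
    by have [_ + _] := FP _ FA; apply; [exact: As|exact: AB Bt].
  - move=> s t p [A FA At]; have [_ _ /(_ s t p At)] := FP _ FA.
    by apply: subset_trans; apply: Irr_annS => q As; exists A.
exists (D A); split=> // t.
pose U := \bigcup_s D A s.
have UX : U `<=` X by move=> p [s _]; exact: AX.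
apply: subset_trans (_ : Irr_ann U `<=` _).
  by move=> r Dr p [s _ Ap]; exact: Aann Ap r Dr.
apply: Xcof => //; apply: contrapT => /infinite_sub_Irr_ann [W [WXU Winf Wann]].
have [w [wI wW]] := infinite_set_seq Winf.
(* Each index receives infinitely many of the points [w n], a set with the same annihilator as
   [W]. *)
pose B := A `|` [set x | exists j : nat, x.1 = w (pickle (x.2, j))].
have nAW p s : W p -> ~ A (p, s).
  by move=> /WXU [_ nU] Ap; apply: nU; exists s.
apply: (Amax B).
  split; first by move=> x; left.
  move=> BA; apply: (nAW (w (pickle (t0, 0%N))) t0) => //.
  by apply: BA; right; exists 0%N; reflexivity.
have AB s : D A s `<=` D B s by move=> p; left.
have DB s p : D B s p -> D A s p \/ exists j : nat, p = w (pickle (s, j)).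
  by move=> [Ap|[j pj]]; [left|right; exists j].
split.
- move=> s p /DB [|[j ->]]; first exact: AX.
  by have [] := WXU _ (wW (pickle (s, j))).
- move=> s u p /DB [As|[i pi]] /DB [Au|[j pj]].
  + exact: Adisj As Au.
  + by case: (nAW p s) => //; rewrite pj.
  + by case: (nAW p u) => //; rewrite pi.
  + by move: pi; rewrite pj => /wI /(pcan_inj pickleK) [].
move=> s u p /DB [Au|[i ->]].
  by apply: subset_trans (Aann s u p Au); exact: Irr_annS.
pose W' := [set w (pickle (s, j)) | j in [set: nat]].
have W'W : W' `<=` W by move=> _ [j _ <-].
have W'inf : infinite_set W'.
  move=> W'fin; apply: infinite_nat; apply: sub_finite_set (_ : _ `<=`
    (fun j => w (pickle (s, j))) @^-1` W') _; first by move=> j _; exists j.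
  by apply: finite_preimage W'fin => a b _ _ /wI /(pcan_inj pickleK) [].
apply: subset_trans (_ : Irr_ann W `<=` _); last by move=> r; apply.
apply: subset_trans (Wann _ W'W W'inf); apply: Irr_annS => _ [j _ <-].
by right; exists j.
Qed.

End IrrAnn.

(** * An element of the product with the least possible annihilator *)

Section FaithfulElement.
Set Implicit Arguments.
Unset Strict Implicit.
Context {R : pzRingType}.
Hypothesis hdim : countable_left_krull_dim R.
Implicit Types (X : set (Irr R)) (p : Irr R).

(** The annihilator of a module is the intersection of the left ideals annihilating its elements;
    countably many of these suffice. *)
Lemma Irr_mod_annihilating_seq p : exists e : nat -> Irr_mod p,
  forall r, (forall i, r *: e i = 0) -> annihilator (Irr_mod p) r.
Proof.
pose L (x : Irr_mod p) : set R^o := [set r | r *: x = 0].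
have subL x : submodule (L x).
  apply/submoduleP; split=> [|a u v Lu Lv]; rewrite /L /= ?scale0r //.
  by rewrite scalerDl -scalerA Lu Lv scaler0 addr0.
have [e eL] := countable_krull_dim_bigcap 0 hdim subL.
by exists e => r re x; apply: eL => // n _; exact: re.
Qed.

Lemma Irr_prod_faithful X (D : seq nat -> set (Irr R)) :
  (forall s, D s `<=` X) -> (forall s t p, D s p -> D t p -> s = t) ->
  (forall s, Irr_ann (D s) `<=` Irr_ann X) ->
  exists m : Irr_prod X, forall r, r *: m = 0 -> Irr_ann X r.
Proof.
move=> DX Ddisj Dann.
have [e eP] : {e : forall p, nat -> Irr_mod p |
    forall p r, (forall i, r *: e p i = 0) -> annihilator (Irr_mod p) r}.
  by exists (fun p => sval (cid (Irr_mod_annihilating_seq p))) => p; case: cid.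
pose hits (r : R) s i := exists2 p, D s p & r *: e p i <> 0.
have hitsP r s : ~ Irr_ann X r -> exists i, hits r s i.
  move=> nXr; apply: contrapT => nh; apply: nXr; apply: (Dann s) => p Dp.
  apply: eP => i; apply: contrapT => ne.
  by apply: nh; exists i, p.
pose L (b : nat -> nat) : set R^o :=
  [set r | exists N, forall n, (N <= n)%N -> ~ hits r (mkseq b n) (b n)].
have subL b : submodule (L b).
  apply/submoduleP; split=> [|a u v [N Nu] [N' Nv]].
    by exists 0%N => n _ [p _]; rewrite scale0r.
  exists (maxn N N') => n; rewrite geq_max => /andP[/Nu nu /Nv nv] [p Dp].
  apply; rewrite scalerDl -scalerA.
  rewrite (_ : (u : R) *: e p (b n) = 0); last first.
    by apply: contrapT => H; apply: nu; exists p.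
  rewrite (_ : (v : R) *: e p (b n) = 0) ?scaler0 ?addr0 //.
  by apply: contrapT => H; apply: nv; exists p.
(* A branch along which every node is hit is never eventually missed. *)
have Lann : \bigcap_b L b `<=` Irr_ann X.
  move=> r Lr; apply: contrapT => nXr.
  have [c cP] := choice (fun s => hitsP r s nXr).
  pose b n := c (iter n (fun s => rcons s (c s)) [::]).
  have bE n : mkseq b n = iter n (fun s => rcons s (c s)) [::].
    by elim: n => // n IH; rewrite mkseqS IH.
  have [N /(_ N (leqnn N))] := Lr b Logic.I; apply.
  by rewrite bE /b; exact: cP.
have [b bL] := countable_krull_dim_bigcap (fun=> 0%N) hdim subL.
(* When several chosen branches pass through [s], the least [k] decides the index used there; the
   value 0 off all branches is arbitrary. *)
pose on k s := mkseq (b k) (size s) == s.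
pose F s := if pselect (exists k, on k s) is left ex
  then b (ex_minn ex) (size s) else 0%N.
(* A branch different from all earlier ones has separated from each of them beyond some level, where
   [F] therefore follows it. *)
have FE k : (forall j, (j < k)%N -> b j <> b k) ->
    exists N, forall n, (N <= n)%N -> F (mkseq (b k) n) = b k n.
  move=> bk.
  have [N NP] : exists N, forall n, (N <= n)%N ->
      forall j, (j < k)%N -> mkseq (b j) n <> mkseq (b k) n.
    suff : forall l, (l <= k)%N -> exists N, forall n, (N <= n)%N ->
        forall j, (j < l)%N -> mkseq (b j) n <> mkseq (b k) n by exact.
    elim=> [|l IH] lk; first by exists 0%N.
    have [N NP] := IH (ltnW lk).
    have [i bi] : exists i, b l i <> b k i.
      apply: contrapT => H; apply: (bk l lk); apply/funext => i.
      by apply: contrapT => H'; apply: H; exists i.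
    exists (maxn N i.+1) => n; rewrite geq_max => /andP[Nn i_n] j.
    rewrite ltnS leq_eqVlt => /orP[/eqP->|jl]; last exact: (NP n Nn j jl).
    by move/(congr1 (nth 0%N ^~ i)); rewrite !nth_mkseq.
  exists N => n Nn; rewrite /F; case: pselect => [ex|[]]; last first.
    by exists k; rewrite /on size_mkseq.
  case: ex_minnP => j; rewrite /on size_mkseq => /eqP jk jmin.
  have jk' : (j <= k)%N by apply: jmin; rewrite eqxx.
  move: jk'; rewrite leq_eqVlt => /orP[/eqP->//|/(NP n Nn j)]; by case.
pose m : Irr_prod X := fun x : {p : Irr R | X p} =>
  if pselect (exists s, D s (sval x)) is left ex
  then e (sval x) (F (sval (cid ex))) else 0.
have mE s p (Xp : X p) : D s p -> m (exist _ p Xp) = e p (F s).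
  move=> Dp; rewrite /m /=; case: pselect => [ex|[]]; last by exists s.
  by case: cid => t /= Dt; rewrite (Ddisj t s p Dt Dp).
exists m => r rm; apply: contrapT => nXr.
have [k0 nLk0] : exists k, ~ L (b k) r.
  apply: contrapT => H; apply: nXr; apply: Lann; apply: bL => k _.
  by apply: contrapT => nL; apply: H; exists k.
(* The sequence [b] may repeat; the least [k] with [r] outside [L (b k)] gives a branch different
   from all earlier ones. *)
have ex : exists k, `[< ~ L (b k) r >] by exists k0; apply/asboolP.
case: (ex_minnP ex) => k /asboolP nLk kmin.
have [|N FN] := FE k.
  move=> j jk bjk; move: jk; rewrite ltnNge => /negP; apply.
  by apply: kmin; apply/asboolP; rewrite bjk.
apply: nLk; exists N => n Nn [p Dp]; apply.
have Xp := DX _ _ Dp.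
rewrite -FN // -(mE _ _ Xp Dp).
exact: (congr1 (fun f : Irr_prod X => f (exist _ p Xp)) rm).
Qed.

End FaithfulElement.

(** * Refined closed sets *)

Section RefinedClosed.
Set Implicit Arguments.
Unset Strict Implicit.
Context {R : pzRingType}.
Implicit Types (X Y Z W : set (Irr R)) (p q : Irr R).

(** The map sending [r *: m] to [r *: s] is well defined since the annihilator of [m] kills [S], and
    onto since [S] is simple. *)
Lemma subquotient_cyclic (M S : lmodType R) (m : M) : simple_module S ->
  (forall r, r *: m = 0 -> annihilator S r) -> subquotient S M.
Proof.
move=> sS mS; have [[s s0] _] := sS; have cS := simple_cyclic sS s0.
have subB : submodule [set r *: m | r in [set: R]].
  apply/submoduleP; split; first by exists 0 => //; rewrite scale0r.
  move=> a _ _ [r _ <-] [t _ <-]; exists (a * r + t) => //.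
  by rewrite scalerDl scalerA.
pose B := submod_type subB.
have BE (x : B) : exists r, r *: m = val x.
  by have := valP x; rewrite inE => -[r _ rx]; exists r.
pose h (x : B) : S := sval (cid (BE x)) *: s.
have hE (x : B) r : r *: m = val x -> h x = r *: s.
  rewrite /h; case: cid => t /= tx rx; apply/eqP.
  rewrite -subr_eq0 -scalerBl; apply/eqP; apply: mS.
  by rewrite scalerBl tx rx subrr.
have hlin : linear h.
  move=> a u v; have [[r ru] [t tv]] := (BE u, BE v).
  rewrite (hE _ _ ru) (hE _ _ tv) (hE _ (a * r + t)) ?scalerDl ?scalerA //.
  by rewrite /= -ru -tv scalerA.
pose H : {linear B -> S} := HB.pack h (GRing.isLinear.Build R B S _ h hlin).
exists B, (val : {linear B -> M}), H; split; first exact: val_inj.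
move=> y; have [r <-] := cS y.
have Br : r *: m \in submod_pred subB by rewrite inE; exists r.
by exists (SubmodType Br); rewrite /= (hE _ r).
Qed.

Lemma subquotient_annihilator (S M : lmodType R) : subquotient S M ->
  annihilator M `<=` annihilator S.
Proof.
move=> [B [i [q [iI qS]]]] r Mr y; have [x <-] := qS y.
rewrite -linearZ_LR (_ : r *: x = 0) ?raddf0 //.
by apply: iI; rewrite linearZ_LR Mr raddf0.
Qed.

Lemma refined_closed_zariski (I : set R) : refined_closed (zariski_closed I).
Proof.
move=> S sS /subquotient_annihilator SX r Ir.
have rS : annihilator S r.
  by apply: SX => f; apply: functional_extensionality_dep => -[p Ip]; exact: Ip.
have [f [g fg gf]] : isomorphic S (Irr_mod (Irr_of sS)).
  by apply/(Irr_of_eq sS (Irr_mod_simple _)); rewrite Irr_modK.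
by move=> x; rewrite -(gf x) -linearZ_LR rS raddf0.
Qed.

(** Simplicity of [M] is used twice: the nonzero image of [i] is all of [M], and the kernel of the
    resulting map from [M] onto [S] is zero. *)
Lemma subquotient_simple (S M : lmodType R) : simple_module S ->
  simple_module M -> subquotient S M -> isomorphic M S.
Proof.
move=> [[s s0] sS] [_ sM] [B [i [q [iI qS]]]].
have subi : submodule [set i x | x in [set: B]].
  apply/submoduleP; split; first by exists 0 => //; rewrite raddf0.
  by move=> a _ _ [u _ <-] [v _ <-]; exists (a *: u + v) => //; rewrite linearP.
have [b qb] := qS s.
have [i0|iT] := sM _ subi.
  case: s0; rewrite -qb (_ : b = 0) ?raddf0 //; apply: iI.
  have : [set i x | x in [set: B]] (i b) by exists b.
  by rewrite i0 raddf0.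
have iE y : exists x, i x = y.
  by have : [set: M] y by []; rewrite -iT => -[x _ <-]; exists x.
have [g ig gi] := bij_linear iI iE.
have subk : submodule [set y | q (g y) = 0].
  have gE a u v : g (a *: u + v) = a *: g u + g v.
    by apply: iI; rewrite linearP !gi.
  apply/submoduleP; split=> [|a u v /= gu gv].
    by rewrite /= (_ : g 0 = 0) ?raddf0 //; apply: iI; rewrite gi raddf0.
  by rewrite gE linearP gu gv scaler0 addr0.
have glin : linear (fun y => q (g y)).
  by move=> a u v; rewrite -linearP; congr (q _); apply: iI;
  rewrite linearP !gi.
pose G : {linear M -> S} :=
  HB.pack (fun y => q (g y)) (GRing.isLinear.Build R M S _ _ glin).
exists G; apply: bij_linear => [u v guv|y]; last first.
  by have [x <-] := qS y; exists (i x); rewrite /= ig.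
have [k0|kT] := sM _ subk.
  have : [set y | q (g y) = 0] (u - v).
    have quv : q (g u) = q (g v) := guv.
    have E : G (u - v) = 0 by rewrite raddfB /= quv subrr.
    exact: E.
  by rewrite k0 /= => /eqP; rewrite subr_eq0 => /eqP.
case: s0; have : [set y | q (g y) = 0] (i b) by rewrite kT.
by rewrite /= ig qb.
Qed.

Lemma refined_closed1 p : refined_closed [set p].
Proof.
move=> S sS SX.
pose P := Irr_prod [set p].
pose ev (f : P) : Irr_mod p := f (exist _ p erefl).
have evlin : linear ev by [].
pose Ev : {linear P -> Irr_mod p} :=
  HB.pack ev (GRing.isLinear.Build R P (Irr_mod p) _ _ evlin).
have evI : injective Ev.
  move=> f g fg; apply: functional_extensionality_dep => -[q e].
  have qp : q = p := e; move: e; rewrite qp => e.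
  by rewrite (Prop_irrelevance e erefl).
have := subquotient_simple sS (Irr_mod_simple p) (subquotient_sub evI SX).
by move/(Irr_of_eq (Irr_mod_simple p) sS); rewrite Irr_modK => <-.
Qed.

Lemma refined_closedP X : countable_left_krull_dim R -> acc_semiprimitive R ->
  refined_closed X -> exists (I : set R) (S : set (Irr R)),
    [/\ semiprimitive I, finite_set S & X = zariski_closed I `|` S].
Proof.
move=> hdim hacc Xc.
have [Y [YX Yfin Ycof]] := cofinite_Irr_ann_max hacc X.
have [D [DY Ddisj Dann]] :=
  @disjoint_Irr_ann _ hacc (seq nat) [::] Y Ycof.
have [m mP] := Irr_prod_faithful hdim DY Ddisj Dann.
exists (Irr_ann Y), (X `\` Y); split=> //; first exact: semiprimitive_Irr_ann.
apply/seteqP; split=> [p Xp|p [pY|[]//]].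
  have [Yp|nYp] := pselect (Y p); [left|by right].
  by move=> r; apply.
(* [Irr_ann Y] kills [N_p] and contains the annihilator of [m], so [N_p] is a quotient of [R m],
   inside the product over [Y]. *)
rewrite -(Irr_modK p); apply: Xc.
apply: (@subquotient_sub R _ _ _ (@ext0 R Y X) (ext0_inj YX)).
by apply: (@subquotient_cyclic _ _ m (Irr_mod_simple p)) => r /mP; exact: pY.
Qed.

End RefinedClosed.

(** * Comparison of the two topologies and the descending chain condition *)

Section Topologies.
Set Implicit Arguments.
Unset Strict Implicit.
Context {R : pzRingType}.

Lemma closed_point_subbase_open (U : set (Irr R)) :
  closed_point_subbase U -> @open (closed_point_Irr R) U.
Proof.
move=> bU; pose V : set (closed_point_Irr R) := U.
suff fU : finI_from (@closed_point_subbase R) idfun V.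
  exists [set V]; last exact: bigcup_set1.
  by move=> _ ->; exact: fU.
by apply: finI_from1.
Qed.

(** Complements of basic open sets are finite unions of points and sets [zariski_closed I], all of
    them refined closed. *)
Lemma closed_point_closed_refined (X : set (Irr R)) :
  @closed (closed_point_Irr R) X -> @closed (refined_Irr R) X.
Proof.
rewrite -!openC => -[B BD <-]; apply: bigcup_open => A /BD [D' sD' <-].
rewrite -closedC setC_bigcap.
apply: closed_bigcup.
  exact: finite_fset.
move=> U D'U; apply/closed_refinedE.
have : closed_point_subbase U by have := sD' U D'U; rewrite inE.
by move=> [[p ->]|[I _ ->]]; rewrite setCK;
  [exact: refined_closed1|exact: refined_closed_zariski].
Qed.

Lemma closed_point_closedU (I : set R) (S : set (Irr R)) : ideal I ->
  finite_set S -> @closed (closed_point_Irr R) (zariski_closed I `|` S).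
Proof.
move=> idI Sfin; apply: closedU.
  by rewrite -openC; apply: closed_point_subbase_open; right; exists I.
have -> : S = \bigcup_(p in S) [set p] by rewrite bigcup_imset1 image_id.
apply: (@closed_bigcup _ (closed_point_Irr R)) => // p _.
by rewrite -openC; apply: closed_point_subbase_open; left; exists p.
Qed.

Lemma decreasing_subset (T : Type) (C : nat -> set T) :
  (forall n, C n.+1 `<=` C n) -> forall m n, (m <= n)%N -> C n `<=` C m.
Proof.
move=> Cdec m n /subnK <-; elim: (n - m)%N => // k IH.
by apply: subset_trans IH; rewrite addSn; exact: Cdec.
Qed.

(** Each of the finitely many points of [S] either leaves the chain at some stage or stays in it
    forever. *)
Lemma finite_setI_eventually_const (S : set (Irr R)) (C : nat -> set (Irr R)) :
  finite_set S -> (forall n, C n.+1 `<=` C n) ->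
  exists n, forall m, (n <= m)%N -> C m `&` S = C n `&` S.
Proof.
move=> /(@finite_seqP (refined_Irr R)) [s ->] Cdec.
have Cle := decreasing_subset Cdec.
suff [n nP] : exists n, forall m p, (n <= m)%N -> p \in s -> C n p -> C m p.
  exists n => m nm; apply/seteqP; split=> p [Cp sp]; split=> //.
    exact: Cle Cp.
  exact: nP Cp.
elim: s => [|q s [n nP]]; first by exists 0%N.
have [[k nk]|qC] := pselect (exists k, ~ C k q).
  exists (maxn n k) => m p; rewrite geq_max => /andP[nm km].
  rewrite inE => /orP[/eqP->|sp] Cp.
    by case: nk; apply: Cle Cp; exact: leq_maxr.
  by apply: (nP m p nm sp); apply: Cle Cp; exact: leq_maxl.
exists n => m p nm; rewrite inE => /orP[/eqP-> _|]; last exact: nP.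
by apply: contrapT => nC; apply: qC; exists m.
Qed.

(** Choose [I] maximal such that some [C n] is [zariski_closed I] up to finitely many points. Later
    terms still contain [zariski_closed I], so they differ only inside a finite set. *)
Lemma refined_noetherian : acc_semiprimitive R ->
  (forall X : set (Irr R), refined_closed X ->
    exists (I : set R) (S : set (Irr R)),
      [/\ semiprimitive I, finite_set S & X = zariski_closed I `|` S]) ->
  noetherian_topology (refined_Irr R).
Proof.
move=> hacc dec C Ccl Cdec.
have {Ccl}Ccl n := (closed_refinedE (C n)).1 (Ccl n).
pose P : set (set R) := [set I | semiprimitive I /\ exists n (S : set (Irr R)),
  [/\ finite_set S, zariski_closed I `<=` C n
    & C n `<=` zariski_closed I `|` S]].
have [|I [_ ?] //|I [spI [n0 [S [Sfin _ CS]]]] Imax] :=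
  acc_semiprimitive_max (P := P) hacc.
  by have [I [S [spI Sfin E]]] := dec _ (Ccl 0%N); exists I; split=> //;
    exists 0%N, S; rewrite E; split=> // p Ip; left.
have Cle := decreasing_subset Cdec.
have IC m : (n0 <= m)%N -> zariski_closed I `<=` C m.
  move=> nm; have [I' [S' [spI' S'fin CS']]] := dec _ (Ccl m).
  (* [Z] equals [C m] up to finitely many points, and [Irr_ann Z] is a semiprimitive ideal defining
     it, so maximality of [I] applies. *)
  pose Z := zariski_closed I `&` zariski_closed I'.
  have IZ : I `<=` Irr_ann Z by move=> r Ir p [Ip _]; exact: Ip.
  have ZJ : zariski_closed (Irr_ann Z) = Z.
    apply/seteqP; split=> [p Jp|p Zp r]; last exact.
    split; first exact: subset_trans IZ Jp.
    by apply: subset_trans Jp => r I'r q [_ I'q]; exact: I'q.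
  have <- : Irr_ann Z = I.
    apply: Imax => //; split; first exact: semiprimitive_Irr_ann.
    exists m, (S `|` S'); rewrite ZJ finite_setU; split=> // [|p Cp].
      by rewrite CS' => p [_ ?]; left.
    have := CS _ (Cle _ _ nm _ Cp); move: Cp; rewrite CS'.
    by move=> [p1|p1] [p2|p2];
      [left; split|right; left|right; right|right; left].
  by rewrite ZJ CS' => p [_ ?]; left.
have [n1 n1P] := finite_setI_eventually_const Sfin Cdec.
exists (maxn n0 n1) => m; rewrite geq_max => /andP[n0m n1m].
have CI k : (n0 <= k)%N -> C k = zariski_closed I `|` (C k `&` S).
  move=> n0k; apply/seteqP; split=> p; last by move=> [/(IC _ n0k)|[]].
  by move=> Cp; case: (CS _ (Cle _ _ n0k _ Cp)); [left|right].
rewrite (CI _ n0m) (CI _ (leq_maxl n0 n1)).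
by rewrite (n1P _ n1m) (n1P _ (leq_maxr n0 n1)).
Qed.

End Topologies.

Theorem theorem4p6 (R : pzRingType)
    (hdim : countable_left_krull_dim R) (hacc : acc_semiprimitive R) :
  [/\ forall X : set (Irr R), @closed (refined_Irr R) X ->
        exists (I : set R) (S : set (Irr R)),
          [/\ semiprimitive I, finite_set S & X = zariski_closed I `|` S],
      forall X : set (Irr R),
        @closed (refined_Irr R) X <-> @closed (closed_point_Irr R) X
    & noetherian_topology (refined_Irr R)].
Proof.
have dec (X : set (Irr R)) (Xc : refined_closed X) :=
  refined_closedP hdim hacc Xc.
split=> [X /closed_refinedE|X|]; first exact: dec.
  split; last exact: closed_point_closed_refined.
  move=> /closed_refinedE /dec [I [S [/semiprimitive_ideal idI Sfin ->]]].
  exact: closed_point_closedU.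
exact: refined_noetherian.
Qed.
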